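(* Let $\Delta$ be a finite set of conditional domain constraints (CDCs) and UINDs (X-UINDs and Y-UINDs) over $R$ such that the CDCs are disjoint with respect to each X-UIND in $\Delta$, and the set of CDCs and Y-UINDs in $\Delta$ is dp-controllable. Then the UINDs are $\{(\mathrm{dp})\}$-separable in $\Delta$ from the CDCs; that is, every horizontal decomposition of $R$ is lossless under $\Delta$ if and only if it is lossless under $\mathrm{cdc}(\Delta^* )$, where $\Delta^*$ is the closure of $\Delta$ under the domain propagation rule $(\mathrm{dp})$.
   Context: Setting. $\mathbf{dom}$ is a (possibly infinite) set of values; $\mathbf{idom}$ is a set of values from a specific interpreted domain (e.g. $\mathbb Z$) on which predicates and functions are defined according to a first-order language $\mathfrak C$ closed under negation. $R$ is a relation symbol of arity $n$ whose first $k$ positions are non-interpreted (values from $\mathbf{dom}$) and whose remaining $n-k$ positions are interpreted (values from $\mathbf{idom}$). Variables $\overline x=(x_1,\dots,x_k)$ refer to non-interpreted positions, $\overline y=(y_1,\dots,y_{n-k})$ to interpreted ones ($y_i$ refers to position $k+i$). $\mathfrak C$-formulae have free variables among $\overline y$; one is satisfiable if some assignment of values of $\mathbf{idom}$ to $\overline y$ makes it true. All instances (associating relation symbols with subsets of $\mathbf{dom}^k\times\mathbf{idom}^{n-k}$) are finite; entailment $\models$ is with respect to finite instances. A CDC is a formula $\forall\overline x,\overline y.\,(R(\overline x,\overline y)\land\lambda(\overline x))\to\delta(\overline y)$, written $\lambda(\overline x)\to\delta(\overline y)$, with antecedent $\lambda$, a Boolean combination of equalities $x_i=a$ with $a\in\mathbf{dom}$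 (possibly $\top$), and consequent $\delta(\overline y)\in\mathfrak C$. $\mathrm{cdc}(\Gamma)$ is the set of all CDCs in $\Gamma$. An X-UIND $R[x_i]\subseteq R[x_j]$ (resp. Y-UIND $R[y_i]\subseteq R[y_j]$) is a unary inclusion dependency between non-interpreted (resp. interpreted) positions: it is satisfied by $I$ if every value in column $i$ (resp. $i+k$) of $R^I$ appears in column $j$ (resp. $j+k$) of $R^I$. UINDs between a non-interpreted and an interpreted position are not allowed. Disjointness: the CDCs of $\Delta$ are disjoint with respect to an X-UIND $R[x_i]\subseteq R[x_j]$ if, for every CDC $\phi_1$ in $\Delta$ whose antecedent mentions $x_j$, the consequent of $\phi_1$ is satisfiable and has no variables in common with the consequent of any CDC $\phi_2$ in $\Delta$ distinct from $\phi_1$. A horizontal decomposition $\Sigma$ is a finite set of view definitions, one for each view symbol $V_1,\dots,V_m$ (each of the same arity and position types as $R$), of the form $\forall\overline x,\overline y.\,V_i(\overline x,\overline y)\leftrightarrow(R(\overline x,\overline y)\land\lambda_i(\overline x)\land\sigma_i(\overline y))$, with $\lambda_i$ a Boolean combination of equalities as for CDCs (possibly $\top$) and $\sigma_i\in\mathfrak C$; the conjunct $\sigma_i$ may be absent. $\Sigma$ is lossless under a set $\Gamma$ of constraints over $R$ if $\Gamma\cup\Sigma\models\forall\overline x,\overline y.\,R(\overline x,\overline y)\leftrightarrow\bigvee_iV_i(\overline x,\overline y)$. Domain propagation rule $(\mathrm{dp})$: from a CDC $\top\to\delta(y_i)$ (where $y_i$ is the only free variable of $\delta$) and a Y-UIND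 $R[y_j]\subseteq R[y_i]$, derive the CDC $\top\to\delta(y_j)$, where the $\mathfrak C$-formula $\delta(y_j)$ is obtained by replacing $y_i$ with $y_j$. dp-controllable: a set of CDCs and Y-UINDs is dp-controllable if, for every Y-UIND $R[y_i]\subseteq R[y_j]$ in it with $i\ne j$, all CDCs in it mentioning the variable $y$, where $y$ is $y_i$ or $y_j$, are of the form $\top\to\delta(y)$ (with $y$ the only free variable of $\delta$). Separability: for a finite set $\mathcal S$ of sound inference rules, the constraints in $\Delta$ other than CDCs are $\mathcal S$-separable in $\Delta$ from the CDCs if every horizontal decomposition is lossless under $\Delta$ exactly when it is lossless under $\mathrm{cdc}(\Delta^* )$, with $\Delta^*$ the closure of $\Delta$ under $\mathcal S$. *)

(* Defs.v *)
From Stdlib Require List.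
From mathcomp Require Import all_boot.
From mathcomp Require Import boolp classical_sets functions cardinality.

Set Implicit Arguments.
Unset Strict Implicit.
Unset Printing Implicit Defensive.

Local Open Scope classical_set_scope.

Record signature := Signature {
  fsym : Type; farity : fsym -> nat;
  psym : Type; parity : psym -> nat }.

Section FirstOrder.
Variable S : signature.

Inductive term (V : Type) : Type :=
| TVar (v : V)
| TApp (f : fsym S) (args : 'I_(farity f) -> term V).

(* [formula V] has its free variables in [V]. Binders are well-scoped de Bruijn
   binders: under a quantifier, [None] is the bound variable and [Some v] is the
   variable [v] of the enclosing scope, so renaming cannot capture. *)
Inductive formula (V : Type) : Type :=
| FFalse
| FEq (t u : term V)
| FPred (p : psym S) (args : 'I_(parity p) -> term V)
| FNot (A : formula V)
| FAnd (A B : formula V)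
| FOr (A B : formula V)
| FImp (A B : formula V)
| FAll (A : formula (option V))
| FEx (A : formula (option V)).

Fixpoint toccurs V (v : V) (t : term V) : Prop :=
  match t with
  | TVar w => w = v
  | TApp _ args => exists i, toccurs v (args i)
  end.

(* Free occurrence. *)
Fixpoint occurs V (v : V) (A : formula V) : Prop :=
  match A with
  | FFalse => False
  | FEq t u => toccurs v t \/ toccurs v u
  | FPred _ args => exists i, toccurs v (args i)
  | FNot A => occurs v A
  | FAnd A B | FOr A B | FImp A B => occurs v A \/ occurs v B
  | FAll A | FEx A => occurs (Some v) A
  end.

Definition only_var V (v : V) (A : formula V) : Prop :=
  forall w, occurs w A <-> w = v.

Fixpoint trename V W (f : V -> W) (t : term V) : term W :=
  match t with
  | TVar v => TVar (f v)
  | TApp g args => TApp (fun i => trename f (args i))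
  end.

Fixpoint rename V W (f : V -> W) (A : formula V) : formula W :=
  match A with
  | FFalse => FFalse W
  | FEq t u => FEq (trename f t) (trename f u)
  | FPred p args => FPred (fun i => trename f (args i))
  | FNot A => FNot (rename f A)
  | FAnd A B => FAnd (rename f A) (rename f B)
  | FOr A B => FOr (rename f A) (rename f B)
  | FImp A B => FImp (rename f A) (rename f B)
  | FAll A => FAll (rename (omap f) A)
  | FEx A => FEx (rename (omap f) A)
  end.

Definition replace (V : eqType) (i j : V) : formula V -> formula V :=
  rename (fun v => if v == i then j else v).

Record structure (D : Type) := Structure {
  fint : forall f : fsym S, ('I_(farity f) -> D) -> D;
  pint : forall p : psym S, ('I_(parity p) -> D) -> Prop }.

Section Semantics.
Variables (D : Type) (M : structure D).

Fixpoint teval V (e : V -> D) (t : term V) : D :=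
  match t with
  | TVar v => e v
  | TApp f args => fint M (fun i => teval e (args i))
  end.

Definition extend V (e : V -> D) (d : D) : option V -> D :=
  fun o => if o is Some v then e v else d.

Fixpoint sat V (e : V -> D) (A : formula V) : Prop :=
  match A with
  | FFalse => False
  | FEq t u => teval e t = teval e u
  | FPred p args => pint M (fun i => teval e (args i))
  | FNot A => ~ sat e A
  | FAnd A B => sat e A /\ sat e B
  | FOr A B => sat e A \/ sat e B
  | FImp A B => sat e A -> sat e B
  | FAll A => forall d, sat (extend e d) A
  | FEx A => exists d, sat (extend e d) A
  end.

Lemma teval_rename V W (f : V -> W) (e : W -> D) (t : term V) :
  teval e (trename f t) = teval (e \o f) t.
Proof.
by elim: t => //= g args IH; congr fint; apply/funext => i; apply: IH.
Qed.

Lemma sat_rename V W (f : V -> W) (e : W -> D) (A : formula V) :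
  sat e (rename f A) <-> sat (e \o f) A.
Proof.
have extE V' W' (g : V' -> W') (e' : W' -> D) d :
    extend e' d \o omap g = extend (e' \o g) d by apply/funext => -[].
elim: A W f e => //=.
- by move=> V' t u W f e; rewrite !teval_rename.
- move=> V' p args W f e; rewrite (_ : (fun _ => _) = fun i => teval (e \o f) (args i)) //.
  by apply/funext => i; rewrite teval_rename.
- by move=> V' A IH W f e; rewrite IH.
- by move=> V' A IHA B IHB W f e; rewrite IHA IHB.
- by move=> V' A IHA B IHB W f e; rewrite IHA IHB.
- by move=> V' A IHA B IHB W f e; rewrite IHA IHB.
- by move=> V' A IH W f e; split=> H d; move: (H d); rewrite IH extE.
- by move=> V' A IH W f e; split=> -[d H]; exists d; move: H; rewrite IH extE.
Qed.

Lemma eq_teval V (e1 e2 : V -> D) (t : term V) :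
  (forall v, toccurs v t -> e1 v = e2 v) -> teval e1 t = teval e2 t.
Proof.
elim: t => [v|f args IH] /= H; first exact: H.
by congr fint; apply/funext => i; apply: IH => v Hv; apply: H; exists i.
Qed.

Lemma eq_sat V (e1 e2 : V -> D) (A : formula V) :
  (forall v, occurs v A -> e1 v = e2 v) -> sat e1 A <-> sat e2 A.
Proof.
elim: A e1 e2 => //=.
- move=> V' t u e1 e2 H; rewrite !(@eq_teval _ e1 e2) // => v Hv; apply: H; auto.
- move=> V' p args e1 e2 H.
  rewrite (_ : (fun i => teval e1 _) = fun i => teval e2 (args i)) //.
  by apply/funext => i; apply: eq_teval => v Hv; apply: H; exists i.
- by move=> V' A IH e1 e2 H; rewrite (IH e1 e2).
- by move=> V' A IHA B IHB e1 e2 H; rewrite (IHA e1 e2) ?(IHB e1 e2) //; auto.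
- by move=> V' A IHA B IHB e1 e2 H; rewrite (IHA e1 e2) ?(IHB e1 e2) //; auto.
- by move=> V' A IHA B IHB e1 e2 H; rewrite (IHA e1 e2) ?(IHB e1 e2) //; auto.
- move=> V' A IH e1 e2 H.
  by split=> HA d; move: (HA d); apply IH => -[v|] //= Hv; rewrite H.
- move=> V' A IH e1 e2 H.
  by split=> -[d HA]; exists d; move: HA; apply IH => -[v|] //= Hv; rewrite H.
Qed.

End Semantics.
End FirstOrder.

(* The language of the interpreted domain: a class of first-order formulae with
   free variables y_i, i : 'I_m. Closure under negation is up to equivalence,
   so that fragments such as difference or linear constraints qualify. *)
Record interpreted_language (idom : Type) (m : nat) := InterpretedLanguage {
  lang_sig : signature;
  lang_str : structure lang_sig idom;
  lang : set (formula lang_sig 'I_m);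
  lang_neg : forall A, lang A ->
    exists2 B, lang B & forall e, sat lang_str e B <-> ~ sat lang_str e A }.

(* Boolean combinations of equalities x_i = a. *)
Inductive bexp (dom : Type) (k : nat) : Type :=
| BTop
| BEq (i : 'I_k) (a : dom)
| BNot (b : bexp dom k)
| BAnd (b c : bexp dom k)
| BOr (b c : bexp dom k).
Arguments BTop {dom k}.

Section HorizontalDecomposition.
(* R has arity k + m: k non-interpreted positions followed by m interpreted
   ones. *)
Variables (dom idom : Type) (k m : nat) (L : interpreted_language idom m).

Local Notation cformula := (formula (lang_sig L) 'I_m).
Local Notation csat := (sat (lang_str L)).

Definition satisfiable (d : cformula) : Prop := exists y : 'I_m -> idom, csat y d.

Fixpoint bsat (x : 'I_k -> dom) (b : bexp dom k) : Prop :=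
  match b with
  | BTop => True
  | BEq i a => x i = a
  | BNot b => ~ bsat x b
  | BAnd b c => bsat x b /\ bsat x c
  | BOr b c => bsat x b \/ bsat x c
  end.

Fixpoint bmentions (j : 'I_k) (b : bexp dom k) : Prop :=
  match b with
  | BTop => False
  | BEq i _ => i = j
  | BNot b => bmentions j b
  | BAnd b c | BOr b c => bmentions j b \/ bmentions j c
  end.

(* [CDC l d] is l -> d; [XUIND i j] is R[x_i] <= R[x_j]; [YUIND i j] is
   R[y_i] <= R[y_j]. *)
Inductive constraint : Type :=
| CDC (l : bexp dom k) (d : cformula)
| XUIND (i j : 'I_k)
| YUIND (i j : 'I_m).

(* CDC consequents must lie in the class [lang L], not just be formulae. *)
Definition admissible (c : constraint) : Prop :=
  if c is CDC _ d then lang d else True.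

Definition cdc (G : set constraint) : set constraint :=
  [set c | G c /\ exists l d, c = CDC l d].

Definition yuinds (G : set constraint) : set constraint :=
  [set c | G c /\ exists i j, c = YUIND i j].

Definition tup : Type := ({ffun 'I_k -> dom} * {ffun 'I_m -> idom})%type.

Definition csatisfied (r : set tup) (c : constraint) : Prop :=
  match c with
  | CDC l d => forall t, r t -> bsat t.1 l -> csat t.2 d
  | XUIND i j => forall t, r t -> exists2 t', r t' & t'.1 j = t.1 i
  | YUIND i j => forall t, r t -> exists2 t', r t' & t'.2 j = t.2 i
  end.

Definition disjoint_wrt (G : set constraint) (j : 'I_k) : Prop :=
  forall l1 d1, G (CDC l1 d1) -> bmentions j l1 ->
    satisfiable d1 /\
    forall l2 d2, G (CDC l2 d2) -> CDC l2 d2 <> CDC l1 d1 ->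
      ~ exists v, occurs v d1 /\ occurs v d2.

(* Disjointness of the CDCs with respect to R[x_i] <= R[x_j] depends on j only. *)
Definition disjoint_xuinds (G : set constraint) : Prop :=
  forall i j, G (XUIND i j) -> disjoint_wrt G j.

Definition dp_controllable (G : set constraint) : Prop :=
  forall i j, G (YUIND i j) -> i <> j ->
    forall y, y = i \/ y = j ->
      forall l d, G (CDC l d) -> occurs y d -> l = BTop /\ only_var y d.

(* A horizontal decomposition with views V_0, ..., V_(nviews - 1). *)
Record decomposition := Decomposition {
  nviews : nat;
  vlambda : 'I_nviews -> bexp dom k;
  vsigma : 'I_nviews -> option cformula; (* [None]: conjunct absent *)
  vsigma_lang : forall i s, vsigma i = Some s -> lang s }.

Record instance (p : nat) := Instance {
  irel : set tup;
  iview : 'I_p -> set tup;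
  irel_fin : finite_set irel;
  iview_fin : forall i, finite_set (iview i) }.

Definition sat_views (Sigma : decomposition) (I : instance (nviews Sigma)) : Prop :=
  forall i t, iview I i t <->
    [/\ irel I t, bsat t.1 (vlambda i) &
        if vsigma i is Some s then csat t.2 s else True].

Definition lossless (G : set constraint) (Sigma : decomposition) : Prop :=
  forall I : instance (nviews Sigma),
    (forall c, G c -> csatisfied (irel I) c) -> sat_views I ->
    forall t, irel I t <-> exists i, iview I i t.

Definition sound_rule (r : seq constraint -> constraint -> Prop) : Prop :=
  forall ps c, r ps c -> forall R : set tup, finite_set R ->
    (forall p, List.In p ps -> csatisfied R p) -> csatisfied R c.

Record rule := Rule {
  derives : seq constraint -> constraint -> Prop;
  rule_sound : sound_rule derives }.

Inductive closure (S : seq rule) (G : set constraint) : set constraint :=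
| closure_incl c : G c -> closure S G c
| closure_step r ps c :
    List.In r S -> (forall p, List.In p ps -> closure S G p) ->
    derives r ps c -> closure S G c.

Definition separable (S : seq rule) (G : set constraint) : Prop :=
  forall Sigma : decomposition,
    lossless G Sigma <-> lossless (cdc (closure S G)) Sigma.

(* When [lang L] is closed under replacing variables, the conclusion is admissible
   whenever the premises are. *)
Inductive dp_derives : seq constraint -> constraint -> Prop :=
| Dp (i j : 'I_m) (d : cformula) : only_var i d ->
    dp_derives [:: CDC BTop d; YUIND j i] (CDC BTop (replace i j d)).

Lemma dp_sound : sound_rule dp_derives.
Proof.
move=> _ _ [i j d di] R _ H t Rt _ /=.
have /(_ t Rt)[t' Rt' tij] := H (YUIND j i) (or_intror (or_introl erefl)).
have /(_ t' Rt' I) Hd := H (CDC BTop d) (or_introl erefl).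
rewrite /replace sat_rename; move: Hd; apply eq_sat => v /di -> /=.
by rewrite eqxx.
Qed.

Definition dp : rule := Rule dp_sound.

End HorizontalDecomposition.

(* Main.v *)
(* Losslessness says that every tuple of every finite model is selected by some
   view, so it suffices to embed each tuple t = (x, y) satisfying the CDCs of the
   closure of Delta into a finite model of Delta. To t add:
   - for each i, the tuple obtained by writing the value x_i at all positions
     that are targets of X-UINDs, and overwriting the variables of the CDCs that
     mention such positions by satisfying assignments of their consequents,
     which disjointness makes possible without affecting any other CDC;
   - for each i, the tuple obtained by writing the value y_i at all positions
     reachable from i along Y-UINDs; the CDCs on these positions hold because
     the domain propagation rule has carried them over to y_i.
   By dp-controllability the first kind of change does not touch the positions
   of nontrivial Y-UINDs. *)
Require Import Defs.
From Stdlib Require Import Relation_Operators.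
From mathcomp Require Import all_boot.
From mathcomp Require Import boolp classical_sets functions cardinality.
Local Open Scope classical_set_scope.

(** * Dependence of formulae on their variables *)

Lemma toccurs_trename (S : signature) (V W : Type) (f : V -> W) (w : W)
    (t : term S V) :
  toccurs w (trename f t) <-> exists2 v, toccurs v t & f v = w.
Proof.
elim: t => [v|g args IH] /=.
  by split=> [<-|[v' -> //]]; exists v.
split=> [[i /IH[v vi fv]]|[v [i vi] fv]]; first by exists v => //; exists i.
by exists i; apply/IH; exists v.
Qed.

Lemma occurs_rename (S : signature) (V W : Type) (f : V -> W) (w : W)
    (A : formula S V) :
  occurs w (rename f A) <-> exists2 v, occurs v A & f v = w.
Proof.
have ex2U X (P Q : X -> Prop) (R : X -> Prop) : (exists2 v, P v \/ Q v & R v) <->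
    (exists2 v, P v & R v) \/ (exists2 v, Q v & R v).
  split=> [[v [] vPQ vR]|[] [v vP vR]]; [left|right| |];
    by exists v => //; by [left|right].
have ex2O X Y (P : option X -> Prop) (h : X -> Y) (y : Y) :
    (exists2 o, P o & omap h o = Some y) <->
    (exists2 v, P (Some v) & h v = y).
  split=> [[[v|] // Pv [hv]]|[v Pv <-]]; first by exists v.
  by exists (Some v).
elim: A W f w => //=.
- by move=> V' W f w; split=> // -[].
- by move=> V' t u W f w; rewrite ex2U !toccurs_trename.
- move=> V' p args W f w; split=> [[i /toccurs_trename[v vi fv]]|[v [i vi] fv]].
    by exists v => //; exists i.
  by exists i; apply/toccurs_trename; exists v.
- by move=> V' A IHA B IHB W f w; rewrite ex2U IHA IHB.
- by move=> V' A IHA B IHB W f w; rewrite ex2U IHA IHB.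
- by move=> V' A IHA B IHB W f w; rewrite ex2U IHA IHB.
- by move=> V' A IH W f w; rewrite IH ex2O.
- by move=> V' A IH W f w; rewrite IH ex2O.
Qed.

Lemma only_var_replace (S : signature) (V : eqType) (i j : V)
    (A : formula S V) : only_var i A -> only_var j (replace i j A).
Proof.
move=> Ai w; rewrite occurs_rename; split=> [[v /Ai -> <-]|->].
  by rewrite eqxx.
by exists i; [apply/Ai | rewrite eqxx].
Qed.

Lemma sat_replace (S : signature) (D : Type) (M : structure S D) (V : eqType)
    (i j : V) (A : formula S V) (e e' : V -> D) :
  only_var i A -> e j = e' i -> sat M e (replace i j A) <-> sat M e' A.
Proof.
by move=> Ai eij; rewrite sat_rename; apply: eq_sat => v /Ai -> /=; rewrite eqxx.
Qed.

Section Separability.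
Set Implicit Arguments.
Unset Strict Implicit.
Variables (dom idom : Type) (k m : nat) (L : interpreted_language idom m).

Local Notation cformula := (formula (lang_sig L) 'I_m).
Local Notation csat := (sat (lang_str L)).
Local Notation constraint := (constraint dom k L).
Local Notation tup := (tup dom idom k m).
Local Notation closure_dp := (Defs.closure [:: dp dom k L]).
Implicit Types (G : set constraint) (R : set tup) (t : tup).

Lemma eq_bsat (x x' : 'I_k -> dom) (b : bexp dom k) :
  (forall j, bmentions j b -> x j = x' j) -> bsat x b <-> bsat x' b.
Proof.
elim: b => [|j a|b IH|b IHb c IHc|b IHb c IHc] //= H.
- by rewrite H.
- by rewrite IH.
- by rewrite IHb ?IHc // => j mj; apply: H; [right|left].
- by rewrite IHb ?IHc // => j mj; apply: H; [right|left].
Qed.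

(** * Reduction of losslessness to single tuples *)

Lemma closure_sound (S : seq (rule dom k L)) G R : finite_set R ->
  (forall c, G c -> csatisfied R c) -> forall c, Defs.closure S G c -> csatisfied R c.
Proof.
move=> Rfin RG c; elim=> [{}c /RG //|r ps {}c _ _ IH rc].
exact: (@rule_sound _ _ _ _ _ r _ _ rc).
Qed.

Definition covered (Sigma : decomposition dom k L) t : Prop :=
  exists i : 'I_(nviews Sigma), bsat t.1 (vlambda i) /\
    if vsigma i is Some s then csat t.2 s else True.

(** The view definitions determine the views from [R], so any finite [R] extends to an instance by
    taking each view to be its selection. *)
Lemma lossless_covered G (Sigma : decomposition dom k L) :
  lossless G Sigma <->
  forall R, finite_set R -> (forall c, G c -> csatisfied R c) ->
    forall t, R t -> covered Sigma t.
Proof.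
split=> [GS R Rfin RG t Rt|GS I IG IS t].
  pose V (i : 'I_(nviews Sigma)) := R `&` [set t : tup | bsat t.1 (vlambda i) /\
    if vsigma i is Some s then csat t.2 s else True].
  have Vfin i : finite_set (V i) by apply: sub_finite_set Rfin => ? [].
  have IS : @sat_views _ _ _ _ _ Sigma (Instance Rfin Vfin).
    by move=> i s; split=> [[? []]|[]].
  by have /(_ t)[/(_ Rt)[i [_ ti]] _] := GS (Instance Rfin Vfin) RG IS; exists i.
split=> [It|[i /IS[]//]].
have [i [ti si]] := GS _ (irel_fin I) IG t It.
by exists i; apply/IS.
Qed.

(** CDCs constrain tuples one at a time, so each tuple of a model of the CDCs is a model by itself,
    to which the extension applies. The converse is soundness of the rules. *)
Lemma separable_extend (S : seq (rule dom k L)) G :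
  (forall t, (forall c, cdc (Defs.closure S G) c -> csatisfied [set t] c) ->
    exists R, [/\ finite_set R, R t & forall c, G c -> csatisfied R c]) ->
  separable S G.
Proof.
move=> ext Sigma; rewrite !lossless_covered; split=> H R Rfin RG t Rt.
  have [c [clc [l [d cE]]]|R' [R'fin R't R'G]] := ext t.
    by rewrite {}cE in clc *; move=> s ->; apply: (RG (CDC l d) _ t Rt);
      split=> //; exists l, d.
  exact: H R'fin R'G _ R't.
by apply: (H R Rfin _ t Rt) => c [clc _]; apply: closure_sound clc.
Qed.

(** * Propagation along Y-UINDs and repair for X-UINDs *)

Definition xtarget G (j : 'I_k) : Prop := exists i, G (XUIND _ L i j).

(** Steps are added at the far end because [dp] pulls a CDC back along the last Y-UIND of a path. *)
Definition yreach G : 'I_m -> 'I_m -> Prop :=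
  clos_refl_trans_n1 _ (fun i j => G (YUIND dom k L i j)).

(** Loops [p = q] are discarded, as dp-controllability says nothing about them. *)
Lemma yreach_target G i j : yreach G i j ->
  i = j \/ exists2 p, G (YUIND _ _ _ p j) & p <> j.
Proof.
elim=> [|p q Gpq _ IH]; first by left.
have [pq|pq] := pselect (p = q); first by rewrite -pq.
by right; exists p.
Qed.

Lemma yreach_sat G t i j (d : cformula) (e : 'I_m -> idom) :
  (forall d, closure_dp G (CDC BTop d) -> csat t.2 d) ->
  yreach G i j -> closure_dp G (CDC BTop d) -> only_var j d ->
  e j = t.2 i -> csat e d.
Proof.
move=> tG ij; elim: ij d e => [|p q Gpq _ IH] d e Gd dj ej.
  by apply/(@eq_sat _ _ _ _ _ (t.2)) => [v /dj -> //|]; apply: tG.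
apply/(@sat_replace _ _ _ _ q p d (fun _ => t.2 i) e dj) => //.
apply: IH => //; last exact: only_var_replace.
apply: (@closure_step _ _ _ _ _ _ _ (dp dom k L) [:: CDC BTop d; YUIND dom k L p q]).
- by left.
- by move=> c [<-|[<-|[]]] //; apply: closure_incl.
- exact: Dp.
Qed.

Lemma xtarget_repair G (y : 'I_m -> idom) :
  (forall j, xtarget G j -> disjoint_wrt G j) ->
  exists y' : {ffun 'I_m -> idom},
    (forall l d j, G (CDC l d) -> xtarget G j -> bmentions j l -> csat y' d) /\
    (forall v, (forall l d j, G (CDC l d) -> xtarget G j -> bmentions j l ->
       ~ occurs v d) -> y' v = y v).
Proof.
move=> Gdisj.
(* One assignment is fixed per consequent; [y] is a dummy for the unsatisfiable ones. *)
have /choice[g gP] : forall d : cformula, exists e, satisfiable d -> csat e d.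
  by move=> d; have [[e ed]|nd] := pselect (satisfiable d); [exists e|exists y].
pose touches v d := occurs v d /\
  exists l j, [/\ G (CDC l d), xtarget G j & bmentions j l].
(* By disjointness at most one consequent [d] touches [v], so the value [g d v] is unambiguous. *)
have /choice[h hP] : forall v, exists w, (forall d, touches v d -> w = g d v) /\
    ((forall d, ~ touches v d) -> w = y v).
  move=> v; have [[d dv]|nv] := pselect (exists d, touches v d); last first.
    by exists (y v); split=> // d dv; case: nv; exists d.
  exists (g d v); split=> [d' d'v|/(_ d)//].
  case: dv => dv [l [j [Gd Gj jl]]]; case: d'v => d'v [l' [j' [Gd' _ _]]].
  have [_ /(_ _ _ Gd') dd'] := Gdisj j Gj l d Gd jl.
  have [[]|ne] := pselect (CDC l' d' = CDC l d :> constraint).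
    by move=> _ ->.
  by case: (dd' ne); exists v.
exists (finfun h); split=> [l d j Gd Gj jl|v nv].
  have [dsat _] := Gdisj j Gj l d Gd jl.
  apply/(@eq_sat _ _ _ _ _ (g d)) => [v vd|]; last exact: gP.
  by rewrite ffunE; apply: (proj1 (hP v)); split=> //; exists l, j.
rewrite ffunE; apply: (proj2 (hP v)) => d [vd [l [j [Gd Gj jl]]]].
exact: nv Gd Gj jl vd.
Qed.

(** * The finite model around a tuple *)

Lemma extend_to_model G t :
  disjoint_xuinds G -> dp_controllable (cdc G `|` yuinds G) ->
  (forall c, cdc (closure_dp G) c -> csatisfied [set t] c) ->
  exists R, [/\ finite_set R, R t & forall c, G c -> csatisfied R c].
Proof.
move=> Gdisj Gdp tG.
have tcdc l d : closure_dp G (CDC l d) -> bsat t.1 l -> csat t.2 d.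
  by move=> Gd; apply: (tG (CDC l d)) => //; split=> //; exists l, d.
have ctrl i j y l d : G (YUIND _ _ _ i j) -> i <> j -> y = i \/ y = j ->
    G (CDC l d) -> occurs y d -> l = BTop /\ only_var y d.
  move=> Gij ij yij Gd; apply: (Gdp i j _ ij y yij l d _).
    by right; split=> //; exists i, j.
  by left; split=> //; exists l, d.
have tdisj j : xtarget G j -> disjoint_wrt G j by move=> [i /Gdisj].
have [y' [y'sat y'eq]] := xtarget_repair (t.2) tdisj.
(* A CDC on an end of a nontrivial Y-UIND has antecedent [BTop], which mentions no target, so the
   repair spares that end. *)
have y'uind i j y : G (YUIND _ _ _ i j) -> i <> j -> y = i \/ y = j ->
    y' y = t.2 y.
  move=> Gij ij yij; apply: y'eq => l d q Gd _ ql yd.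
  by have [lE _] := ctrl _ _ _ _ _ Gij ij yij Gd yd; move: ql; rewrite lE.
pose tx (i : 'I_k) : tup :=
  ([ffun j => if `[< xtarget G j >] then t.1 i else t.1 j], y').
pose ty (i : 'I_m) : tup :=
  (t.1, [ffun j => if `[< yreach G i j >] then t.2 i else t.2 j]).
exists ([set t] `|` (range tx `|` range ty)); split; last 1 first.
- case=> [l d|i j|i j] Gc /=.
  + move=> _ [->|[[i _ <-]|[i _ <-]]] /=.
    * exact/tcdc/closure_incl.
    (* If [l] mentions no target, it has the same truth value at [tx i] as at [t], and disjointness
       keeps the repair off the variables of [d]. *)
    * have [[j [Gj jl]] _|nl] := pselect (exists j, xtarget G j /\ bmentions j l).
        exact: y'sat Gc Gj jl.
      move=> bl; apply/(@eq_sat _ _ _ _ _ (t.2)) => [v vd|]; last first.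
        apply: tcdc (closure_incl _ Gc) _; apply: (proj1 (eq_bsat _) bl) => j jl.
        by rewrite ffunE asboolF // => Gj; case: nl; exists j.
      apply: y'eq => l' d' j Gd' Gj jl' vd'.
      have [_ /(_ _ _ Gc) dd'] := tdisj j Gj _ _ Gd' jl'.
      case: dd'; last by exists v.
      by case=> ll' _; case: nl; exists j; rewrite ll'.
    * move=> bl.
      have [[j [ij nij jd]]|nd] :=
          pselect (exists j, [/\ yreach G i j, i <> j & occurs j d]).
        have [//|[p Gpj pj]] := yreach_target ij.
        have [lE dj] := ctrl _ _ _ _ _ Gpj pj (or_intror erefl) Gc jd.
        apply: yreach_sat (ij) _ dj _.
        - by move=> d' Gd'; apply: tcdc Gd' Logic.I.
        - by rewrite -lE; apply: closure_incl.
        - by rewrite ffunE asboolT.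
      apply/(@eq_sat _ _ _ _ _ (t.2)) => [v vd|]; last first.
        exact: tcdc (closure_incl _ Gc) bl.
      rewrite ffunE; case: asboolP => // iv.
      have [-> //|niv] := pselect (i = v).
      by case: nd; exists v.
  + have Gj : xtarget G j by exists i.
    (* Every non-interpreted entry at [i] in the model is some [t.1 p], and [tx p] carries it at
       [j]. *)
    have txR p : exists2 s, ([set t] `|` (range tx `|` range ty)) s &
        s.1 j = t.1 p.
      exists (tx p); first by right; left; exists p.
      by rewrite ffunE asboolT.
    move=> _ [->|[[p _ <-]|[p _ <-]]] //=.
    by rewrite ffunE; case: ifP.
  + have [<- s Rs|ij] := pselect (i = j); first by exists s.
    have tyR : exists2 s, ([set t] `|` (range tx `|` range ty)) s &
        s.2 j = t.2 i.
      exists (ty i); first by right; right; exists i.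
      rewrite ffunE asboolT //.
      by apply: rtn1_trans Gc _; apply: rtn1_refl.
    move=> _ [->|[[p _ <-]|[p _ <-]]] //=.
      by rewrite (y'uind i j) //; left.
    (* If [p] does not reach [i], the entry is [t.2 i], found in [ty i]; otherwise [p] reaches [j]
       too and [ty p] is its own witness. *)
    rewrite ffunE; case: asboolP => // pi.
    exists (ty p); first by right; right; exists p.
    by rewrite ffunE asboolT //; apply: rtn1_trans Gc pi.
- by rewrite !finite_setU; do !split=> //; apply: finite_image.
- by left.
Qed.

End Separability.

Theorem theorem11 (dom idom : Type) (k m : nat)
    (L : interpreted_language idom m) (Delta : set (constraint dom k L))
    (Delta_fin : finite_set Delta)
    (Delta_adm : forall c, Delta c -> admissible c)
    (Delta_disj : disjoint_xuinds Delta)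
    (Delta_dp : dp_controllable (cdc Delta `|` yuinds Delta)) :
  separable [:: dp dom k L] Delta.
Proof.
by apply: separable_extend => t; apply: extend_to_model.
Qed.
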